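(* Let $M$ be a compact connected $C^\infty$-manifold of positive dimension with fixed volume form $\lambda$, $\int_M d\lambda=1$. Among the $\alpha$-connections $\nabla^{(\alpha)}$, $\alpha\in\mathbb{R}$, on $\mathcal{P}^+(M)$, the only ones which are flat and dual to each other are the $e$-connection $\nabla^{(+1)}$ and the $m$-connection $\nabla^{(-1)}$; that is, $\nabla^{(\alpha)}$ and $\nabla^{(-\alpha)}$ are mutually dual with respect to the Fisher metric and flat if and only if $\alpha\in\{+1,-1\}$.
   Context: $\mathcal{P}^+(M)$ is the set of probability measures $\mu=f\lambda$ on $M$ with $f\in C^0(M)$ everywhere positive. Its tangent space at every $\mu$ is $\mathcal{V}=\{h\lambda : h\in C^0(M),\ \int_M h\,d\lambda=0\}$. The Fisher metric is $G_\mu(\tau,\tau_1)=\int_M\frac{d\tau}{d\mu}\frac{d\tau_1}{d\mu}\,d\mu$. Each $\tau\in\mathcal{V}$ is regarded as a constant vector field on $\mathcal{P}^+(M)$, with integral curves $t\mapsto\mu+t\tau$. For $\alpha\in\mathbb{R}$ put $\rho^{(\alpha)}(f\lambda)=\frac{2}{1-\alpha}f^{(1-\alpha)/2}$ if $\alpha\ne1$ and $\rho^{(1)}(f\lambda)=\log f$. The $\alpha$-connection is defined on constant vector fields $\tau,\tau_1,\tau_2$ by $$G_\mu(\nabla^{(\alpha)}_\tau\tau_1,\tau_2)=\int_M\frac{\partial^2}{\partial t\partial t_1}\rho^{(\alpha)}(\mu(t,t_1,t_2))\,\frac{\partial}{\partial t_2}\rho^{(-\alpha)}(\mu(t,t_1,t_2))\Big|_{t=t_1=t_2=0}\,d\lambda,$$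 where $\mu(t,t_1,t_2)=\mu+t\tau+t_1\tau_1+t_2\tau_2$; explicitly, $(\nabla^{(\alpha)}_\tau\tau_1)_\mu=-\frac{1+\alpha}2\left(\frac{d\tau}{d\mu}\frac{d\tau_1}{d\mu}-G_\mu(\tau,\tau_1)\right)\mu$. It extends to a non-constant vector field $Y:\mathcal{P}^+(M)\to\mathcal{V}$ in the usual way: $(\nabla^{(\alpha)}_\tau Y)_\mu=\frac{d}{dt}\big|_{t=0}Y_{\mu+t\tau}+(\nabla^{(\alpha)}_\tau Y_\mu)_\mu$, where in the last term $Y_\mu\in\mathcal{V}$ is regarded as a constant vector field. The curvature tensor is $R^{(\alpha)}(\tau_1,\tau_2)\tau=\nabla^{(\alpha)}_{\tau_1}\nabla^{(\alpha)}_{\tau_2}\tau-\nabla^{(\alpha)}_{\tau_2}\nabla^{(\alpha)}_{\tau_1}\tau$ for constant vector fields, and the (torsion-free) connection is flat if $R^{(\alpha)}=0$. Connections $\nabla,\nabla^*$ are dual with respect to $G$ if $\tau\,G(\tau_1,\tau_2)=G(\nabla_\tau\tau_1,\tau_2)+G(\tau_1,\nabla^*_\tau\tau_2)$ for all constant vector fields, where the left side at $\mu$ is $\frac{d}{dt}\big|_{t=0}G_{\mu+t\tau}(\tau_1,\tau_2)$. *)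

(* Defs.v *)
From HB Require Import structures.
From mathcomp Require Import all_boot all_order all_algebra.
From mathcomp Require Import all_classical all_reals all_analysis.

Set Implicit Arguments.
Unset Strict Implicit.
Unset Printing Implicit Defensive.

Import Order.TTheory GRing.Theory Num.Theory.
Import numFieldNormedType.Exports.

Local Open Scope classical_set_scope.
Local Open Scope ring_scope.

(* iter_deriv f [:: v1; ...; vk] = 'D_v1 (... ('D_vk f)) *)
Fixpoint iter_deriv (R : realType) (V W : normedModType R) (f : V -> W)
    (s : seq V) : V -> W :=
  if s is v :: s' then fun x => 'D_v (iter_deriv f s') x else f.

(* f is C^oo on U; meant for U open *)
Definition smooth_on (R : realType) (V W : normedModType R)
    (U : set V) (f : V -> W) : Prop :=
  forall (s : seq V) (x : V), U x ->
    {for x, continuous (iter_deriv f s)} /\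
    forall v, derivable (iter_deriv f s) x v.

(* Borel sets are available in the library for pointed types only, whence
   ptopologicalType: the base point only says that M is nonempty.

   chart_map is a homeomorphism from the open set chart_dom onto an open
   subset of R^n, with inverse chart_inv; the values of chart_map and chart_inv
   outside these two sets are irrelevant. *)
Record chart (R : realType) (n : nat) (M : ptopologicalType) := Chart {
  chart_dom : set M;
  chart_map : M -> 'rV[R]_n;
  chart_inv : 'rV[R]_n -> M;
  chart_dom_open : open chart_dom;
  chart_codom_open : open (chart_map @` chart_dom);
  chart_mapK : {in chart_dom, cancel chart_map chart_inv};
  chart_map_continuous : {within chart_dom, continuous chart_map};
  chart_inv_continuous :
    {within chart_map @` chart_dom, continuous chart_inv} }.

(* the change of coordinates from c to c' *)
Definition transition (R : realType) (n : nat) (M : ptopologicalType)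
    (c c' : chart R n M) : 'rV[R]_n -> 'rV[R]_n :=
  fun y => chart_map c' (chart_inv c y).

(* the domain of definition of [transition c c'] *)
Definition overlap (R : realType) (n : nat) (M : ptopologicalType)
    (c c' : chart R n M) : set 'rV[R]_n :=
  chart_map c @` (chart_dom c `&` chart_dom c').

Record smooth_atlas (R : realType) (n : nat) (M : ptopologicalType) :=
  SmoothAtlas {
    atlas_index : Type;
    atlas_chart : atlas_index -> chart R n M;
    atlas_cover : forall x : M, exists i, chart_dom (atlas_chart i) x;
    atlas_smooth : forall i j,
      smooth_on (overlap (atlas_chart i) (atlas_chart j))
                (transition (atlas_chart i) (atlas_chart j)) }.

(* A nowhere vanishing C^oo n-form, given in the i-th chart by
   [vol_density i] dx_1 /\ ... /\ dx_n; the compatibility condition is the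
   transformation law of n-forms. *)
Record volume_form (R : realType) (n : nat) (M : ptopologicalType)
    (A : smooth_atlas R n M) := VolumeForm {
  vol_density : atlas_index A -> 'rV[R]_n -> R;
  vol_smooth : forall i,
    smooth_on (chart_map (atlas_chart i) @` chart_dom (atlas_chart i))
              (vol_density i : 'rV[R]_n -> R^o);
  vol_neq0 : forall i (x : M), chart_dom (atlas_chart i) x ->
    vol_density i (chart_map (atlas_chart i) x) != 0;
  vol_compat : forall i j (y : 'rV[R]_n),
    overlap (atlas_chart i) (atlas_chart j) y ->
    vol_density i y =
      vol_density j (transition (atlas_chart i) (atlas_chart j) y)
      * \det (jacobian (transition (atlas_chart i) (atlas_chart j)) y) }.

(* Iterated Lebesgue integral over the n coordinates.  By Tonelli it is the
   integral with respect to n-dimensional Lebesgue measure when f is Borel and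
   nonnegative, the only case in which it is used. *)
Fixpoint lebesgue_int (R : realType) (n : nat) :
    ('rV[R]_n -> \bar R) -> \bar R :=
  match n return ('rV[R]_n -> \bar R) -> \bar R with
  | 0%N => fun f => f 0
  | m.+1 => fun f =>
      (\int[@lebesgue_measure R]_(x in [set: R])
         lebesgue_int (fun y : 'rV[R]_m =>
           f (row_mx (x%:M : 'rV[R]_1) y)))%E
  end.

Notation borel M := (g_sigma_algebraType (@open M)).

(* lam is the Borel measure A |-> \int_A omega, for the orientation of M
   defined by omega *)
Definition is_volume_measure (R : realType) (n : nat) (M : ptopologicalType)
    (A : smooth_atlas R n M) (omega : volume_form A)
    (lam : {measure set (borel M) -> \bar R}) : Prop :=
  forall (i : atlas_index A) (B : set (borel M)),
    measurable B -> B `<=` chart_dom (atlas_chart i) ->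
    lam B = lebesgue_int (fun y =>
      (`|vol_density omega i y|
       * \1_(chart_map (atlas_chart i) @` B) y)%:E).

(* Measures f lam and h lam with continuous f, h are represented by their
   densities f, h : M -> R.  As lam charges every nonempty open set, the
   continuous density is unique, so that this is a bijection onto P^+(M), resp.
   its tangent space. *)
Section statistical_model.
Context (R : realType) (M : ptopologicalType).
Variable lam : {measure set (borel M) -> \bar R}.

Definition Pplus : set (M -> R) :=
  [set f : M -> R | [/\ continuous f, forall x, 0 < f x
             & \int[lam]_(x in setT) f x = 1]].

Definition tangent : set (M -> R) :=
  [set h : M -> R | continuous h /\ \int[lam]_(x in setT) h x = 0].

(* dtau/dmu = tau / mu, and dmu = mu dlam *)
Definition fisher (mu tau tau1 : M -> R) : R :=
  \int[lam]_(x in setT) ((tau x / mu x) * (tau1 x / mu x) * mu x).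

Definition line (mu : M -> R) (t : R) (tau : M -> R) : M -> R :=
  fun x => mu x + t * tau x.

Definition rho (alpha : R) (f : M -> R) : M -> R :=
  fun x => if alpha == 1 then ln (f x)
           else 2 / (1 - alpha) * f x `^ ((1 - alpha) / 2).

(* mu(t, t1, t2) *)
Definition affine3 (mu tau tau1 tau2 : M -> R) (t t1 t2 : R) : M -> R :=
  line (line (line mu t tau) t1 tau1) t2 tau2.

Definition alpha_rhs (alpha : R) (mu tau tau1 tau2 : M -> R) : R :=
  let m := affine3 mu tau tau1 tau2 in
  \int[lam]_(x in setT)
    (derive1 (fun t : R =>
        derive1 (fun t1 : R => rho alpha (m t t1 0) x) 0) 0
     * derive1 (fun t2 : R => rho (- alpha) (m 0 0 t2) x) 0).

(* A connection is given by its values on constant vector fields: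
   [nabla tau tau1 mu] is (nabla_tau tau1)_mu. *)
Definition connection := (M -> R) -> (M -> R) -> (M -> R) -> (M -> R).

(* the tangent vector sigma such that G_mu(sigma, tau2) is the given expression
   for all tau2; it is unique because G_mu is positive definite *)
Definition alpha_connection (alpha : R) : connection :=
  fun tau tau1 mu =>
    get [set sigma : M -> R | tangent sigma /\
      forall tau2, tangent tau2 ->
        fisher mu sigma tau2 = alpha_rhs alpha mu tau tau1 tau2].

(* the derivative at 0 of a curve in C^0(M), for the topology of uniform
   convergence *)
Definition curve_deriv0 (c : R -> M -> R) : M -> R :=
  get [set h : M -> R |
    {uniform, (fun (t : R) (x : M) => t^-1 * (c t x - c 0 x)) @ 0^' --> h}].

(* Vector fields are maps Y : (M -> R) -> (M -> R), of which only the values on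
   Pplus matter: [line mu t tau] is in Pplus for small t. *)
Definition covariant_deriv (nabla : connection) (tau : M -> R)
    (Y : (M -> R) -> (M -> R)) : (M -> R) -> (M -> R) :=
  fun mu x =>
    curve_deriv0 (fun t => Y (line mu t tau)) x + nabla tau (Y mu) mu x.

Definition curvature (nabla : connection) (tau1 tau2 tau : M -> R) :
    (M -> R) -> (M -> R) :=
  fun mu x =>
    covariant_deriv nabla tau1 (covariant_deriv nabla tau2 (cst tau)) mu x
    - covariant_deriv nabla tau2 (covariant_deriv nabla tau1 (cst tau)) mu x.

Definition flat (nabla : connection) : Prop :=
  forall tau1 tau2 tau mu,
    tangent tau1 -> tangent tau2 -> tangent tau -> Pplus mu ->
    forall x, curvature nabla tau1 tau2 tau mu x = 0.

Definition dual_connections (nabla nabla' : connection) : Prop :=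
  forall tau tau1 tau2 mu,
    tangent tau -> tangent tau1 -> tangent tau2 -> Pplus mu ->
    is_derive (0 : R) (1 : R)
      (fun t : R => fisher (line mu t tau) tau1 tau2)
      (fisher mu (nabla tau tau1 mu) tau2
       + fisher mu tau1 (nabla' tau tau2 mu)).

End statistical_model.

(* Main.v *)
Require Import Defs.
From HB Require Import structures.
From mathcomp Require Import all_boot all_order all_algebra.
From mathcomp Require Import all_classical all_reals all_analysis.
From mathcomp Require Import measurable_realfun.
From mathcomp Require Import ring lra.

Set Implicit Arguments.
Unset Strict Implicit.
Unset Printing Implicit Defensive.

Import Order.TTheory GRing.Theory Num.Theory.
Import numFieldNormedType.Exports.

Local Open Scope classical_set_scope.
Local Open Scope ring_scope.

(** Write k = (1 + alpha)/2, G = G_mu for the Fisher metric, and let f, g, h be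
densities of tangent vectors.  Differentiating the powers (or the logarithm) in
the definition of the alpha-connection gives
<<
  G(nabla_f g, h) = - k int f g h / mu^2 dlam,
>>
so that (nabla_f g)_mu = - k (f g / mu - G(f, g) mu); this vector is determined
by the formula because G is positive definite on continuous densities, which in
turn holds because a volume form charges every nonempty open set.

Duality.  The integral above is symmetric in f, g, h, and the factors k for
alpha and for - alpha add up to 1.  Hence G(nabla_f g, h) + G(g, nabla*_f h) is
- int f g h / mu^2, the derivative of G_{mu + t f}(g, h) = int g h / (mu + t f)
at t = 0.  So nabla^(alpha) and nabla^(-alpha) are dual for every alpha
([dual_alpha_connections]).

Flatness.  Differentiate - k (g h / mu - G(g, h) mu) along f and add nabla_f of
its value at mu.  The terms that are symmetric in f and g cancel in the
curvature, which leaves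
<<
  R(f, g) h = k (1 - k) (G(g, h) f - G(f, h) g),
  where k (1 - k) = (1 - alpha^2) / 4
>>
([curvatureE]): a tensor of constant curvature.  It vanishes when alpha is 1 or
-1.  For other alpha it is nonzero at mu = lam as soon as the tangent space
contains two independent vectors; these are obtained by centering g and g^2,
where g is a Urysohn function, which takes all values in [0, 1] because M is
connected and is not a point.

The derivatives along curves of densities are derivatives for uniform
convergence.  All curves that occur are quotients, products and integrals of
affine ones, and they satisfy c t = c 0 + t h + O(t^2) uniformly on M; this
property [expands] is stable under these operations, and yields both the
derivative of a curve of functions and the derivative of a real function. *)

(** * A volume form charges every nonempty open set *)

(** The integral of a nonnegative function is a supremum over the simple functions
below it, and this supremum is monotone for arbitrary functions.  The inner
integrals of [lebesgue_int] can thus be compared although nothing is known about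
their measurability. *)
Lemma ge0_le_integral_nonmeas d (T : measurableType d) (R : realType)
    (mu : {measure set T -> \bar R}) (f g : T -> \bar R) :
  (forall x, 0 <= f x)%E -> (forall x, f x <= g x)%E ->
  (\int[mu]_x f x <= \int[mu]_x g x)%E.
Proof.
move=> f0 fg; rewrite !ge0_integralTE//; last first.
  by move=> x; exact: le_trans (f0 x) (fg x).
apply: ereal_sup_le => _ [h hf <-]; exists h => // x.
exact: le_trans (hf x) (fg x).
Qed.

Lemma lebesgue_int_ge0 (R : realType) (n : nat) (f : 'rV[R]_n -> \bar R) :
  (forall y, 0 <= f y)%E -> (0 <= lebesgue_int f)%E.
Proof.
elim: n f => [|n IHn] f f0 /=; first exact: f0.
by apply: integral_ge0 => x _; apply: IHn.
Qed.

Lemma ball_row_mx (R : realType) (n : nat) (y : 'rV[R]_n.+1) (e x : R)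
    (z : 'rV[R]_n) :
  0 < e -> ball (y 0 0) e x -> ball (rsubmx (y : 'rV_(1 + n))) e z ->
  ball y e (row_mx (x%:M : 'rV[R]_1) z).
Proof.
move=> e0 yx [_ yz]; split=> // i j; rewrite !ord1 {i}.
have [k|k] := @split_ordP 1 n j => ->.
  rewrite [X in ball _ _ X](_ : _ = x); last first.
    by rewrite [LHS](row_mxEl (x%:M : 'rV[R]_1)) ord1 mxE eqxx mulr1n.
  by rewrite (_ : lshift n k = 0)//; apply: val_inj; rewrite ord1.
rewrite [X in ball _ _ X](_ : _ = z 0 k); last first.
  exact: (row_mxEr (x%:M : 'rV[R]_1)).
by have := yz 0 k; rewrite mxE.
Qed.

(** The norm of 'rV[R]_n is the sup norm, so that its balls are cubes and the
iterated integral of the indicator of a ball can be computed one coordinate at a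
time. *)
Lemma lebesgue_int_ge_ball (R : realType) (n : nat) (f : 'rV[R]_n -> \bar R)
    (y : 'rV[R]_n) (e c : R) :
  0 < e -> 0 <= c -> (forall z, 0 <= f z)%E ->
  (forall z, ball y e z -> c%:E <= f z)%E ->
  ((c * (e *+ 2) ^+ n)%:E <= lebesgue_int f)%E.
Proof.
move=> e0 c0; elim: n f y => [|n IHn] f y f0 cf /=.
  rewrite expr0 mulr1.
  by apply: cf; rewrite [0](_ : _ = y) ?thinmx0//; exact: ballxx.
set K := c * (e *+ 2) ^+ n.
have mB : measurable (ball (y 0 0) e).
  by apply: open_measurable; apply: ball_open.
have K0 : 0 <= K by rewrite mulr_ge0// exprn_ge0// mulrn_wge0// ltW.
apply: (@le_trans _ _ (\int[@lebesgue_measure R]_x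
    (K%:E * (\1_(ball (y 0 0) e) x)%:E))%E).
  rewrite ge0_integralZl//.
  - rewrite integral_indic ?setIT//.
    rewrite [X in (_ * X)%E](_ : _ = (e *+ 2)%:E); last first.
      exact: (lebesgue_measure_ball (y 0 0) (ltW e0)).
    by rewrite exprSr mulrA EFinM.
  - by apply/measurable_EFinP; exact: measurable_indic.
apply: ge0_le_integral_nonmeas => x.
  by rewrite -EFinM lee_fin mulr_ge0.
rewrite indicE; have [xy|xy] := boolP (x \in _); last first.
  by rewrite mule0; apply: lebesgue_int_ge0.
rewrite mule1; apply: (IHn _ (rsubmx (y : 'rV_(1 + n)))) => // z yz.
by apply: cf; apply: ball_row_mx => //; move: xy; rewrite inE.
Qed.

Lemma chart_image_nbhs (R : realType) (n : nat) (M : ptopologicalType)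
    (c : chart R n M) (U : set M) (x : M) :
  open U -> U x -> chart_dom c x ->
  nbhs (chart_map c x) (chart_map c @` (U `&` chart_dom c)).
Proof.
move=> oU Ux cx.
have Vx : (chart_map c @` chart_dom c) (chart_map c x) by exists x.
have nV : nbhs (chart_map c x) (chart_map c @` chart_dom c).
  by apply: open_nbhs_nbhs; split => //; exact: chart_codom_open.
have := @chart_inv_continuous _ _ _ c.
rewrite continuous_open_subspace; last exact: chart_codom_open.
move=> /(_ (chart_map c x)); rewrite inE => /(_ Vx).
rewrite /continuous_at chart_mapK ?inE// => /(_ U) invU.
have nU : nbhs (chart_map c x) [set y | U (chart_inv c y)].
  by apply: invU; exact: open_nbhs_nbhs.
apply: filterS2 nV nU => _ [x' cx' <-] /=.
by rewrite chart_mapK ?inE// => Ux'; exists x'.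
Qed.

(** In a chart the density of the volume form is continuous and nonzero, hence
bounded below on a small cube contained in the image of U. *)
Lemma measure_open_gt0 (R : realType) (n : nat) (M : ptopologicalType)
    (A : smooth_atlas R n M) (omega : volume_form A)
    (lam : {measure set (borel M) -> \bar R}) (U : set M) :
  is_volume_measure omega lam -> open U -> U !=set0 -> (0 < lam U)%E.
Proof.
move=> hlam oU [x Ux]; have [i ix] := atlas_cover A x.
set c := atlas_chart i; set B : set (borel M) := U `&` chart_dom c.
have oB : open (U `&` chart_dom c) by apply: openI => //; exact: chart_dom_open.
have mB : measurable B by exact: sub_sigma_algebra.
have mU : measurable (U : set (borel M)) by exact: sub_sigma_algebra.
apply: (@lt_le_trans _ _ (lam B)); last first.
  by apply: le_measure; rewrite ?inE//; exact: subIsetl.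
rewrite (hlam i)//; last exact: subIsetr.
set y := chart_map c x; set d := vol_density omega i.
have dy0 : 0 < `|d y| by rewrite normr_gt0; exact: vol_neq0.
have cd : {for y, continuous (d : 'rV[R]_n -> R^o)}.
  by have [+ _] := @vol_smooth _ _ _ _ omega i [::] y (ex_intro2 _ _ x ix erefl).
have nd : \forall z \near y, `|d y| / 2 < `|d z|.
  have /cvgrPdist_lt/(_ (`|d y| / 2)) := cd.
  rewrite divr_gt0// => /(_ isT).
  apply: filterS => z dyz; have := lerB_dist (d y) (d z).
  by move: dyz; lra.
have /nbhs_ballP[e /= e0 yeB] :
    nbhs y [set z | (chart_map c @` B) z /\ `|d y| / 2 < `|d z|].
  by apply: filterI => //; exact: chart_image_nbhs.
apply: (@lt_le_trans _ _ (`|d y| / 2 * (e *+ 2) ^+ n)%:E).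
  by rewrite lte_fin mulr_gt0 ?divr_gt0// exprn_gt0// pmulrn_lgt0.
apply: (@lebesgue_int_ge_ball _ _ _ y) => //.
move=> z /yeB[Bz dz]; rewrite lee_fin indicE mem_set// mulr1.
exact: ltW.
Qed.

(** * Continuous functions on a compact space and their integrals *)

Definition bounded_fun (R : realType) (M : Type) (f : M -> R) :=
  exists2 C : R, 0 < C & forall x : M, `|f x| <= C.

Lemma continuous_bounded_fun (R : realType) (M : ptopologicalType) (f : M -> R) :
  compact [set: M] -> continuous f -> bounded_fun f.
Proof.
move=> cM cf; have : bounded_set (f @` [set: M]).
  by apply/compact_bounded/continuous_compact => //; exact: continuous_subspaceT.
move=> /ex_strict_bound_gt0[C C0 fC]; exists C => // x.
by apply: ltW; apply: fC; exists x.
Qed.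

Lemma compact_gt0_ge (R : realType) (M : ptopologicalType) (f : M -> R) :
  compact [set: M] -> continuous f -> (forall x, 0 < f x) ->
  exists2 m, 0 < m & forall x, m <= f x.
Proof.
move=> cM cf f0.
have [||c _ fc] := @compact_EVT_min _ _ f setT _ cM.
- by exists point.
- exact: continuous_subspaceT.
by exists (f c) => // x; apply: fc; rewrite inE.
Qed.

Section continuous_functions.
Context (R : realType) (M : topologicalType).
Implicit Types f g : M -> R.

Lemma continuous_cst_fun (r : R) : continuous (fun _ : M => r).
Proof. by move=> x; exact: cvg_cst. Qed.

Lemma continuous_add f g :
  continuous f -> continuous g -> continuous (fun x => f x + g x).
Proof. by move=> cf cg x; apply: cvgD; [exact: cf|exact: cg]. Qed.

Lemma continuous_opp f : continuous f -> continuous (fun x => - f x).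
Proof. by move=> cf x; apply: cvgN; exact: cf. Qed.

Lemma continuous_mul f g :
  continuous f -> continuous g -> continuous (fun x => f x * g x).
Proof. by move=> cf cg x; apply: cvgM; [exact: cf|exact: cg]. Qed.

Lemma continuous_div f g : (forall x, 0 < g x) ->
  continuous f -> continuous g -> continuous (fun x => f x / g x).
Proof.
move=> g0 cf cg x; apply: cvgM; first exact: cf.
by apply: cvgV; [rewrite gt_eqF|exact: cg].
Qed.

End continuous_functions.

(** The rules are selected by the syntax of the function: applying the lemmas by
unification makes higher-order unification explore conversions at length. *)
Ltac continuity := repeat match goal with
  | H : continuous ?f |- continuous ?f => exact H
  | |- continuous (fun _ => ?r) => exact (@continuous_cst_fun _ _ r)
  | |- continuous (fun x => @?f x + @?g x) => refine (@continuous_add _ _ f g _ _)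
  | |- continuous (fun x => - @?f x) => refine (@continuous_opp _ _ f _)
  | |- continuous (fun x => @?f x / @?g x) => refine (@continuous_div _ _ f g _ _ _)
  | |- continuous (fun x => @?f x * @?g x) => refine (@continuous_mul _ _ f g _ _)
  | _ => assumption
  end.

Section integral_continuous.
Context (R : realType) (M : ptopologicalType).
Variable lam : {measure set (borel M) -> \bar R}.
Implicit Types f g : M -> R.
Hypothesis hMc : compact [set: M].
Hypothesis hlam1 : lam setT = 1%E.

Local Notation E f := (\int[lam]_(x in setT) f x).

Lemma continuous_borel_measurable f :
  continuous f -> measurable_fun [set: borel M] f.
Proof.
move=> cf; apply: (measurability _ (RGenOpens.measurableE R)).
move=> _ [_ [a [b ->] <-]]; rewrite setTI; apply: sub_sigma_algebra.
by move/continuousP : cf; apply; exact: interval_open.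
Qed.

Lemma continuous_integrable f :
  continuous f -> lam.-integrable [set: borel M] (EFin \o f).
Proof.
move=> cf; apply: measurable_bounded_integrable => //.
- by rewrite [X in (X < _)%E](_ : _ = 1%E)// ltry.
- exact: continuous_borel_measurable.
have [C _ fC] := continuous_bounded_fun hMc cf.
exists C; split => [|D CD x _ /=]; first exact: num_real.
exact: le_trans (fC x) (ltW CD).
Qed.

Lemma integral_add f g : continuous f -> continuous g ->
  E (fun x => f x + g x) = E f + E g.
Proof. by move=> cf cg; apply: RintegralD => //; exact: continuous_integrable. Qed.

Lemma integral_sub f g : continuous f -> continuous g ->
  E (fun x => f x - g x) = E f - E g.
Proof. by move=> cf cg; apply: RintegralB => //; exact: continuous_integrable. Qed.

Lemma integral_scale (r : R) f : continuous f ->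
  E (fun x => r * f x) = r * E f.
Proof. by move=> cf; apply: RintegralZl => //; exact: continuous_integrable. Qed.

Lemma integral_const (r : R) : E (fun=> r) = r.
Proof.
by rewrite Rintegral_cst//= [X in fine X](_ : _ = 1%E)//= mulr1.
Qed.

Lemma integral_abs_le f (C : R) : continuous f -> (forall x, `|f x| <= C) ->
  `|E f| <= C.
Proof.
move=> cf fC.
apply: le_trans (le_normr_Rintegral _ (continuous_integrable cf)) _ => //.
rewrite -[leRHS]integral_const; apply: le_Rintegral => //.
- apply: continuous_integrable => x; apply: cvg_norm; exact: cf.
- by apply: continuous_integrable; exact: continuous_cst_fun.
Qed.

Hypothesis lam_open : forall U : set M, open U -> U !=set0 -> (0 < lam U)%E.

Lemma integral_eq0_continuous f : continuous f -> (forall x, 0 <= f x) ->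
  E f = 0 -> forall x, f x = 0.
Proof.
move=> cf f0 If x; apply/eqP/negP => /negP fx.
have fx0 : 0 < f x by rewrite lt_neqAle eq_sym fx f0.
pose U : set (borel M) := f @^-1` [set y | f x / 2 < y].
have oU : open (U : set M) by move/continuousP : cf; apply; exact: open_gt.
have mU : measurable U by exact: sub_sigma_algebra.
have lamU : (0 < lam U)%E.
  by apply: lam_open => //; exists x => /=; rewrite /U/=; lra.
have : (\int[lam]_(y in setT) (f x / 2 * \1_U y)%:E <=
        \int[lam]_(y in setT) (f y)%:E)%E.
  apply: ge0_le_integral_nonmeas => y; rewrite lee_fin indicE.
    by rewrite mulr_ge0// divr_ge0// ltW.
  have [|_] := boolP (y \in U); last by rewrite mulr0.
  by rewrite inE mulr1 /U/= => /ltW.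
have -> : (\int[lam]_(y in setT) (f y)%:E = 0)%E.
  rewrite -[LHS]fineK; first by congr EFin; exact: If.
  exact: (integrable_fin_num _ (continuous_integrable cf)).
under eq_integral do rewrite EFinM.
rewrite ge0_integralZl//; last 2 first.
  - by apply/measurable_EFinP; exact: measurable_indic.
  - by rewrite lee_fin divr_ge0// ltW.
rewrite integral_indic// setIT leNgt => /negP; apply.
by rewrite mule_gt0// lte_fin divr_gt0.
Qed.

End integral_continuous.

(** * Curves of functions with a uniform first-order expansion *)

Lemma difference_quotient_dist_lt (R : realType) (t y D C e : R) :
  t != 0 -> `|t| < e / (`|C| + 1) -> `|y - t * D| <= C * t ^+ 2 ->
  `|D - t^-1 * y| < e.
Proof.
move=> t0; rewrite ltr_pdivlMr ?ltr_pwDr// => te ytD.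
have -> : D - t^-1 * y = - t^-1 * (y - t * D) by field.
rewrite normrM normrN normfV mulrC ltr_pdivrMr ?normr_gt0//.
apply: le_lt_trans ytD _; rewrite -real_normK ?num_real// expr2 mulrA.
rewrite ltr_pM2r ?normr_gt0//.
by have := ler_norm C; have := normr_ge0 t; nra.
Qed.

Section uniform_expansion.
Context (R : realType) (M : ptopologicalType).
Implicit Types (c d : R -> M -> R) (h k mu tau p : M -> R).

(** The curve c has derivative h at 0, with a remainder O(t^2) which is uniform
on M.  The quadratic remainder, stronger than differentiability, makes the
stability under products and quotients a matter of explicit bounds. *)
Definition expands c h := exists C : R, \forall t \near (0 : R),
  forall x, `|c t x - c 0 x - t * h x| <= C * t ^+ 2.

Lemma uniform_cvg_distP (T : Type) (F : set_system T) {FF : Filter F}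
    (u : T -> M -> R) h :
  {uniform, u @ F --> h} <->
  forall e, 0 < e -> \forall t \near F, forall x, `|h x - u t x| < e.
Proof.
split=> [uh e e0|uh P].
  apply: (uh [set g | forall x, `|h x - g x| < e]).
  apply/uniform_nbhs; exists [set xy | `|xy.1 - xy.2| < e]; split.
    by rewrite -entourage_ballE; exists e.
  by move=> g /= gh x; exact: gh.
move=> /uniform_nbhs[E [+ EP]].
rewrite -entourage_ballE => -[e /= e0 eE].
near=> t; apply: EP => x _; apply: eE => /=.
by move: x; near: t; exact: uh.
Unshelve. end_near. Qed.

(** [curve_deriv0] picks one uniform limit of the difference quotients; it is h
because uniform limits are unique, being pointwise limits in R. *)
Lemma expands_curve_deriv0 c h : expands c h -> curve_deriv0 c = h.
Proof.
move=> [C ch].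
have Ph : {uniform, (fun t x => t^-1 * (c t x - c 0 x)) @ 0^' --> h}.
  apply: (proj2 (uniform_cvg_distP _ _)) => e e0.
  near=> t => x; apply: (@difference_quotient_dist_lt _ _ _ _ C).
  - by near: t; exact: nbhs_dnbhs_neq.
  - by near: t; apply: dnbhs0_lt; rewrite divr_gt0// ltr_pwDr.
  - by move: x; near: t; exact: nbhs_dnbhs.
have := getPex (ex_intro _ h Ph : exists g, {uniform, _ @ _ --> g}).
rewrite -/(curve_deriv0 c); set g := curve_deriv0 c => Pg.
apply/funext => x; apply/eqP; rewrite -subr_eq0 -normr_le0 leNgt.
apply/negP => gh; have e0 : 0 < `|g x - h x| / 2 by rewrite divr_gt0.
have {}Pg := proj1 (uniform_cvg_distP _ _) Pg _ e0.
have {}Ph := proj1 (uniform_cvg_distP _ _) Ph _ e0.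
have [t [gt ht]] := filter_ex (filterI (Pg _) (Ph _)).
have := ler_distD (t^-1 * (c t x - c 0 x)) (g x) (h x).
rewrite (distrC (t^-1 * _) (h x)); have := gt x; have := ht x; lra.
Unshelve. all: end_near. Qed.

Lemma is_derive_quadratic (F : R -> R) (D C : R) :
  (\forall t \near (0 : R), `|F t - F 0 - t * D| <= C * t ^+ 2) ->
  is_derive (0 : R) (1 : R) F D.
Proof.
move=> FD.
have lim :
  (fun h : R => h^-1 *: ((F \o shift 0) (h *: (1 : R)) - F 0)) @ 0^' --> D.
  apply/cvgrPdist_lt => e e0.
  near=> t; rewrite /= addr0 /GRing.scale/= mulr1.
  apply: (@difference_quotient_dist_lt _ _ _ _ C).
  - by near: t; exact: nbhs_dnbhs_neq.
  - by near: t; apply: dnbhs0_lt; rewrite divr_gt0// ltr_pwDr.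
  - by near: t; exact: nbhs_dnbhs.
by apply: DeriveDef; [exact: cvgP lim|exact: cvg_lim lim].
Unshelve. all: end_near. Qed.

End uniform_expansion.

Section expansion_calculus.
Context (R : realType) (M : ptopologicalType).
Implicit Types (c d : R -> M -> R) (h k mu tau p : M -> R).

Lemma expands_near c d h : (\forall t \near (0 : R), c t = d t) ->
  expands c h -> expands d h.
Proof.
move=> cd [C ch]; exists C; have cd0 := nbhs_singleton cd.
by apply: filterS2 cd ch => t <-; rewrite -cd0.
Qed.

Lemma expands_exact c h : (forall t x, c t x = c 0 x + t * h x) -> expands c h.
Proof.
move=> ch; exists 0; near=> t => x.
by rewrite ch mul0r [X in `|X|](_ : _ = 0) ?normr0//; ring.
Unshelve. end_near. Qed.

Lemma expands_add c d h k : expands c h -> expands d k ->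
  expands (fun t x => c t x + d t x) (fun x => h x + k x).
Proof.
move=> [C ch] [D dk]; exists (C + D); apply: filterS2 ch dk => t ch dk x.
rewrite [X in `|X|](_ : _ =
  (c t x - c 0 x - t * h x) + (d t x - d 0 x - t * k x)); last by ring.
by rewrite mulrDl (le_trans (ler_normD _ _))// lerD.
Qed.

Lemma expands_scale (r : R) c h : expands c h ->
  expands (fun t x => r * c t x) (fun x => r * h x).
Proof.
move=> [C ch]; exists (`|r| * C); apply: filterS ch => t ch x.
rewrite [X in `|X|](_ : _ = r * (c t x - c 0 x - t * h x)); last by ring.
by rewrite normrM -mulrA ler_wpM2l.
Qed.

Lemma expands_mul c d h k :
  bounded_fun (c 0) -> bounded_fun h -> bounded_fun (d 0) -> bounded_fun k ->
  expands c h -> expands d k ->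
  expands (fun t x => c t x * d t x) (fun x => c 0 x * k x + h x * d 0 x).
Proof.
move=> [c0 c0_gt0 c0P] [h0 h0_gt0 hP] [d0 d0_gt0 d0P] [k0 k0_gt0 kP].
move=> [C ch] [D dk].
(* With remainders r of c and s of d, the remainder of the product is
   t^2 h k + (c 0 + t h) s + r (d 0 + t k + s), and |t| <= 1. *)
exists (h0 * k0 + (c0 + h0) * `|D| + `|C| * (d0 + k0 + `|D|)).
near=> t.
have t1 : `|t| <= 1 by near: t; apply: (@nbhs0_le R R 1).
have cht : forall x, `|c t x - c 0 x - t * h x| <= C * t ^+ 2 by near: t.
have dkt : forall x, `|d t x - d 0 x - t * k x| <= D * t ^+ 2 by near: t.
move=> x.
have t2 : t ^+ 2 <= 1.
  by rewrite -real_normK ?num_real// expr_le1.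
have t20 : 0 <= t ^+ 2 by exact: sqr_ge0.
set r := c t x - c 0 x - t * h x; set s := d t x - d 0 x - t * k x.
have rt : `|r| <= `|C| * t ^+ 2.
  apply: (@le_trans _ _ (C * t ^+ 2)); first exact: cht.
  by rewrite ler_wpM2r// ler_norm.
have st : `|s| <= `|D| * t ^+ 2.
  apply: (@le_trans _ _ (D * t ^+ 2)); first exact: dkt.
  by rewrite ler_wpM2r// ler_norm.
have th : `|t * h x| <= h0.
  by rewrite normrM -[leRHS]mul1r ler_pM.
have tk : `|t * k x| <= k0.
  by rewrite normrM -[leRHS]mul1r ler_pM.
rewrite [X in `|X|](_ : _ =
  t ^+ 2 * (h x * k x) + (c 0 x + t * h x) * s + r * (d 0 x + t * k x + s));
  last by rewrite /r /s; ring.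
rewrite [leRHS]mulrDl; apply: (le_trans (ler_normD _ _)); apply: lerD.
  rewrite [leRHS]mulrDl; apply: (le_trans (ler_normD _ _)); apply: lerD.
    by rewrite normrM ger0_norm// mulrC ler_wpM2r// normrM ler_pM.
  rewrite normrM -mulrA ler_pM//.
  by apply: (le_trans (ler_normD _ _)); apply: lerD.
rewrite normrM mulrAC ler_pM//.
apply: (le_trans (ler_normD _ _)); apply: lerD; last first.
  by apply: (le_trans st); rewrite -[leRHS]mulr1 ler_wpM2l.
by apply: (le_trans (ler_normD _ _)); apply: lerD.
Unshelve. all: end_near. Qed.

Lemma near_line_ge mu tau (m : R) : 0 < m -> (forall x, m <= mu x) ->
  bounded_fun tau -> \forall t \near (0 : R), forall x, m / 2 <= line mu t tau x.
Proof.
move=> m0 mum [T T0 tauT]; near=> t => x; rewrite /line.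
have tT : `|t| <= m / 2 / T.
  by near: t; apply: (@nbhs0_le R R (m / 2 / T)); rewrite !divr_gt0.
have : `|t * tau x| <= m / 2.
  by rewrite normrM -[leRHS](@divfK _ T) ?gt_eqF// ler_pM.
by rewrite ler_norml => /andP[+ _]; have := mum x; lra.
Unshelve. all: end_near. Qed.

(** The remainder is exactly t^2 tau^2 / (mu^2 (mu + t tau)). *)
Lemma expands_inv_line mu tau (m : R) : 0 < m -> (forall x, m <= mu x) ->
  bounded_fun tau ->
  expands (fun t x => (line mu t tau x)^-1) (fun x => - (tau x / mu x ^+ 2)).
Proof.
move=> m0 mum bt; have nl := near_line_ge m0 mum bt.
have [T T0 tauT] := bt; exists (T ^+ 2 / (m ^+ 2 * (m / 2))).
apply: filterS nl => t tm x.
have lx := tm x; have mux := mum x.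
have l0 : 0 < line mu t tau x by apply: lt_le_trans lx; rewrite divr_gt0.
have mu0 : 0 < mu x by exact: lt_le_trans mux.
have -> : line mu 0 tau x = mu x by rewrite /line mul0r addr0.
rewrite [X in `|X|](_ : _ =
  t ^+ 2 * (tau x ^+ 2 / (mu x ^+ 2 * line mu t tau x))); last first.
  by move: l0; rewrite /line => l0; field; rewrite !gt_eqF.
rewrite normrM ger0_norm ?sqr_ge0// mulrC ler_wpM2r ?sqr_ge0//.
rewrite normrM normfV [X in _ / X]ger0_norm; last first.
  by rewrite mulr_ge0 ?sqr_ge0// ltW.
rewrite ler_pM//.
- by rewrite invr_ge0 mulr_ge0 ?sqr_ge0// ltW.
- by rewrite normrX lerXn2r ?nnegrE// ltW.
rewrite lef_pV2 ?posrE ?mulr_gt0 ?exprn_gt0 ?divr_gt0//.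
by rewrite ler_pM ?sqr_ge0 ?divr_ge0 ?(ltW m0)// lerXn2r ?nnegrE// ltW.
Qed.

Lemma expands_line mu tau : expands (fun t => line mu t tau) tau.
Proof. by apply: expands_exact => t x; rewrite /line mul0r addr0. Qed.

End expansion_calculus.

(** * The derivatives defining the alpha-connection *)

Section scalar_derivatives.
Context (R : realType).
Implicit Types (alpha a b u y : R).

Definition rho_fun alpha y : R :=
  if alpha == 1 then ln y else 2 / (1 - alpha) * y `^ ((1 - alpha) / 2).

Lemma is_derive_affine (g : R -> R) b : (forall t, g t = g 0 + t * b) ->
  is_derive (0 : R) (1 : R) g b.
Proof.
move=> gE; apply: (@is_derive_quadratic _ _ _ 0); near=> t.
by rewrite gE mul0r [X in `|X|](_ : _ = 0) ?normr0//; ring.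
Unshelve. end_near. Qed.

(** The exponent - (1 + alpha)/2 also covers the logarithm, for alpha = 1. *)
Lemma is_derive_rho_fun alpha y : 0 < y ->
  is_derive y (1 : R) (rho_fun alpha) (y `^ (- ((1 + alpha) / 2))).
Proof.
move=> y0; rewrite /rho_fun; have [->|a1] := eqVneq alpha 1.
  by rewrite divff// powR_inv1 ?ltW//; exact: is_derive1_ln.
apply: is_derive_eq.
  exact: (is_deriveZ (2 / (1 - alpha)) (is_derive1_powR ((1 - alpha) / 2) y0)).
have a1' : 1 - alpha != 0 by rewrite subr_eq0 eq_sym.
rewrite /GRing.scale/= mulrA (_ : 2 / (1 - alpha) * ((1 - alpha) / 2) = 1) ?mul1r.
  by congr (_ `^ _); field.
by field.
Qed.

Lemma derive1_rho_affine alpha (g : R -> R) b : 0 < g 0 ->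
  (forall t, g t = g 0 + t * b) ->
  derive1 (fun t => rho_fun alpha (g t)) 0 = g 0 `^ (- ((1 + alpha) / 2)) * b.
Proof.
move=> g0 gE; rewrite derive1E.
have [_ <-] := is_derive1_comp (is_derive_rho_fun alpha g0) (is_derive_affine gE).
by [].
Qed.

(** The powers of u left by the two factors are - (1 + alpha)/2 - 1 and
- (1 - alpha)/2; their sum - 2 does not depend on alpha. *)
Lemma derive1_rho_rho alpha u a b c : 0 < u ->
  derive1 (fun t => derive1 (fun t1 =>
      rho_fun alpha (u + t * a + t1 * b + 0 * c)) 0) 0
  * derive1 (fun t2 => rho_fun (- alpha) (u + 0 * a + 0 * b + t2 * c)) 0
  = - ((1 + alpha) / 2) * (a * b * c / u ^+ 2).
Proof.
move=> u0.
rewrite (@derive1_rho_affine _ (fun t2 => u + 0 * a + 0 * b + t2 * c) c);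
  last 2 first.
  - by rewrite !mul0r !addr0.
  - by move=> t; ring.
have near_pos : \forall t \near (0 : R), 0 < u + t * a.
  have a1 : 0 < `|a| + 1 by rewrite ltr_pwDr.
  have := @nbhs0_lt R R (u / (`|a| + 1)); rewrite divr_gt0// => /(_ isT).
  apply: filterS => t; rewrite ltr_pdivlMr// mulrDr mulr1 -normrM => ta.
  by have := ler_norm (- (t * a)); rewrite normrN; have := normr_ge0 t; lra.
set k := (1 + alpha) / 2.
have -> : derive1 (fun t => derive1 (fun t1 =>
    rho_fun alpha (u + t * a + t1 * b + 0 * c)) 0) 0
    = b * (- k * u `^ (- k - 1) * a).
  rewrite derive1E.
  pose h (t : R) : R := b *: (u + t * a) `^ (- k).
  apply: (@etrans _ _ ('D_1 h 0)).
    apply: near_eq_derive; apply: filterS near_pos => t ut.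
    rewrite (@derive1_rho_affine _ (fun t1 => u + t * a + t1 * b + 0 * c) b).
    - by rewrite !mul0r !addr0 mulrC.
    - by rewrite !mul0r !addr0.
    - by move=> s; ring.
  have ga : forall t, u + t * a = u + 0 * a + t * a by move=> t; ring.
  have u0' : 0 < u + 0 * a by rewrite mul0r addr0.
  have [_] := is_deriveZ b (@is_derive1_comp R (@powR R ^~ (- k))
    (fun t => u + t * a) 0 _ _ (is_derive1_powR (- k) u0') (is_derive_affine ga)).
  by rewrite mul0r addr0.
rewrite !mul0r !addr0.
have -> : (u ^+ 2)^-1 = u `^ (- k - 1) * u `^ (- ((1 - alpha) / 2)).
  rewrite -powRD; last by apply/implyP => _; rewrite gt_eqF.
  rewrite -powR_mulrn ?ltW// -powRN; congr (_ `^ _).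
  by rewrite /k; field.
by ring.
Qed.

End scalar_derivatives.

(** * Explicit alpha-connections, duality and curvature *)

Section alpha_connections.
Context (R : realType) (M : ptopologicalType).
Variable lam : {measure set (borel M) -> \bar R}.
Implicit Types (alpha : R) (c : R -> M -> R) (f g h p mu : M -> R).
Hypothesis hMc : compact [set: M].
Hypothesis hlam1 : lam setT = 1%E.
Hypothesis lam_open : forall U : set M, open U -> U !=set0 -> (0 < lam U)%E.

Local Notation E f := (\int[lam]_(x in setT) f x).
Local Notation nabla alpha := (alpha_connection lam alpha).
Local Notation Pplus := (Pplus lam).
Local Notation tangent := (tangent lam).

Lemma fisherE mu f g : (forall x, 0 < mu x) ->
  fisher lam mu f g = E (fun x => f x * g x / mu x).
Proof.
move=> mu0; apply: eq_Rintegral => x _; have := mu0 x => mux.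
by field; rewrite gt_eqF.
Qed.

Lemma alpha_rhsE alpha mu f g h : (forall x, 0 < mu x) ->
  continuous mu -> continuous f -> continuous g -> continuous h ->
  alpha_rhs lam alpha mu f g h =
  - ((1 + alpha) / 2) * E (fun x => f x * g x * h x / (mu x * mu x)).
Proof.
move=> mu0 cmu cf cg ch.
have mumu0 x : 0 < mu x * mu x by exact: mulr_gt0.
rewrite -integral_scale//; last by continuity.
apply: eq_Rintegral => x _.
exact: (derive1_rho_rho alpha (f x) (g x) (h x) (mu0 x)).
Qed.

(** The value at mu of the alpha-derivative of the constant field g along f; the
second term makes the integral vanish. *)
Definition alpha_christoffel alpha f g mu : M -> R := fun x =>
  - ((1 + alpha) / 2) *
  (f x * g x / mu x - E (fun y => f y * g y / mu y) * mu x).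

Lemma alpha_christoffel_tangent alpha f g mu :
  continuous f -> continuous g -> Pplus mu ->
  tangent (alpha_christoffel alpha f g mu).
Proof.
move=> cf cg [cmu mu0 Emu].
have cfg : continuous (fun x => f x * g x / mu x) by continuity.
split; first by rewrite /alpha_christoffel; continuity.
rewrite integral_scale//; last by continuity.
rewrite integral_sub//; last by continuity.
by rewrite integral_scale// Emu mulr1 subrr mulr0.
Qed.

Lemma fisher_christoffel alpha f g h mu : continuous f -> continuous g ->
  tangent h -> Pplus mu ->
  fisher lam mu (alpha_christoffel alpha f g mu) h =
  - ((1 + alpha) / 2) * E (fun x => f x * g x * h x / (mu x * mu x)).
Proof.
move=> cf cg [ch Eh] [cmu mu0 Emu]; rewrite fisherE//.
have mumu0 x : 0 < mu x * mu x by exact: mulr_gt0.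
have cfgh : continuous (fun x => f x * g x * h x / (mu x * mu x)) by continuity.
set e := E (fun y => f y * g y / mu y).
apply: (@etrans _ _ (E (fun x => - ((1 + alpha) / 2) *
    (f x * g x * h x / (mu x * mu x) - e * h x)))).
  apply: eq_Rintegral => x _; rewrite /alpha_christoffel -/e.
  by field; rewrite gt_eqF.
rewrite integral_scale//; last by continuity.
rewrite integral_sub//; last by continuity.
by rewrite integral_scale// Eh mulr0 subr0.
Qed.

(** Test with h = f - g: the integral of (f - g)^2 / mu vanishes. *)
Lemma fisher_nondegenerate mu f g : Pplus mu -> tangent f -> tangent g ->
  (forall h, tangent h -> fisher lam mu f h = fisher lam mu g h) -> f = g.
Proof.
move=> [cmu mu0 _] [cf Ef] [cg Eg] fg.
have cd : continuous (fun x => f x - g x) by continuity.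
have td : tangent (fun x => f x - g x).
  by split => //; rewrite integral_sub// Ef Eg subrr.
have := fg _ td; rewrite !fisherE// => /eqP; rewrite -subr_eq0 -integral_sub//;
  [|by continuity..].
move=> /eqP Ed; apply/funext => x.
pose q y := (f y - g y) * (f y - g y) / mu y.
have : q x = 0.
  apply: (integral_eq0_continuous hMc hlam1 lam_open).
  - by rewrite /q; continuity.
  - move=> y; apply: divr_ge0; last exact/ltW.
    by have := sqr_ge0 (f y - g y); rewrite expr2.
  - rewrite -Ed; apply: eq_Rintegral => y _; rewrite /q.
    by field; rewrite gt_eqF.
move=> /eqP; rewrite /q mulf_eq0 invr_eq0 (gt_eqF (mu0 x)) orbF mulf_eq0 orbb.
by rewrite subr_eq0 => /eqP.
Qed.

Lemma alpha_connectionE alpha f g mu :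
  continuous f -> continuous g -> Pplus mu ->
  nabla alpha f g mu = alpha_christoffel alpha f g mu.
Proof.
move=> cf cg muP; have [cmu mu0 _] := muP.
have gamma_def : tangent (alpha_christoffel alpha f g mu) /\
    forall h, tangent h -> fisher lam mu (alpha_christoffel alpha f g mu) h =
      alpha_rhs lam alpha mu f g h.
  split; first exact: alpha_christoffel_tangent.
  by move=> h th; rewrite fisher_christoffel// alpha_rhsE//; case: th.
have [tn nE] : tangent (nabla alpha f g mu) /\ forall h, tangent h ->
    fisher lam mu (nabla alpha f g mu) h = alpha_rhs lam alpha mu f g h.
  exact: (getPex (ex_intro (fun s => tangent s /\ forall h, tangent h ->
    fisher lam mu s h = alpha_rhs lam alpha mu f g h) _ gamma_def)).
apply: (fisher_nondegenerate muP tn gamma_def.1) => h th.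
by rewrite gamma_def.2//; exact: nE.
Qed.

Lemma near_line_Pplus mu f : Pplus mu -> tangent f ->
  \forall t \near (0 : R), Pplus (line mu t f).
Proof.
move=> [cmu mu0 Emu] [cf Ef].
have [m m0 mum] := compact_gt0_ge hMc cmu mu0.
apply: filterS (near_line_ge m0 mum (continuous_bounded_fun hMc cf)) => t tm.
split.
- by rewrite /line; continuity.
- by move=> x; apply: lt_le_trans (tm x); rewrite divr_gt0.
by rewrite integral_add//; [rewrite integral_scale// Emu Ef mulr0 addr0|continuity].
Qed.

Lemma expands_integral c h : (\forall t \near (0 : R), continuous (c t)) ->
  continuous h -> expands c h ->
  expands (fun t (_ : M) => E (c t)) (fun=> E h).
Proof.
move=> cc ch [C chC]; have cc0 := nbhs_singleton cc.
exists C; apply: filterS2 cc chC => t cct chCt _.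
rewrite -integral_scale// -integral_sub// -integral_sub//; [|by continuity..].
by apply: integral_abs_le => //; continuity.
Qed.

Lemma expands_div_line p mu f : continuous p -> continuous f -> Pplus mu ->
  expands (fun t x => p x / line mu t f x)
          (fun x => - (p x * f x / (mu x * mu x))).
Proof.
move=> cp cf [cmu mu0 _].
have mumu0 x : 0 < mu x * mu x by exact: mulr_gt0.
have [m m0 mum] := compact_gt0_ge hMc cmu mu0.
have bd g : continuous g -> bounded_fun g by exact: continuous_bounded_fun.
have line0 x : line mu 0 f x = mu x by rewrite /line mul0r addr0.
have := @expands_mul R M (fun=> p) (fun t x => (line mu t f x)^-1) (fun=> 0)
  (fun x => - (f x / mu x ^+ 2)).
rewrite (_ : (fun x => p x * _ + _) =
  (fun x => - (p x * f x / (mu x * mu x)))); last first.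
  apply/funext => x; rewrite mul0r addr0 expr2; ring.
apply.
- exact: bd.
- by apply: bd; continuity.
- rewrite (_ : (fun x => _) = (fun x => 1 / mu x)).
    by apply: bd; continuity.
  by apply/funext => x; rewrite line0 div1r.
- by apply: (bd (fun x => - (f x / (mu x * mu x)))); continuity.
- by apply: expands_exact => t x; rewrite mulr0 addr0.
- exact: (expands_inv_line m0 mum (bd _ cf)).
Qed.

Lemma expands_integral_div_line p mu f :
  continuous p -> tangent f -> Pplus mu ->
  expands (fun t (_ : M) => E (fun x => p x / line mu t f x))
          (fun=> E (fun x => - (p x * f x / (mu x * mu x)))).
Proof.
move=> cp tf muP; have [cf _] := tf; have [cmu mu0 _] := muP.
have mumu0 x : 0 < mu x * mu x by exact: mulr_gt0.
apply: expands_integral; last exact: expands_div_line.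
  by apply: filterS (near_line_Pplus muP tf) => t [clt lt0 _]; continuity.
by continuity.
Qed.

(** Both sides are - int f g h / mu^2, since (1 + alpha)/2 + (1 - alpha)/2 = 1. *)
Lemma dual_alpha_connections alpha :
  dual_connections lam (nabla alpha) (nabla (- alpha)).
Proof.
move=> f g h mu tf tg th muP.
have [cf _] := tf; have [cg _] := tg; have [ch _] := th.
have [cmu mu0 _] := muP.
have mumu0 x : 0 < mu x * mu x by exact: mulr_gt0.
have fisherC a b : fisher lam mu a b = fisher lam mu b a.
  by apply: eq_Rintegral => x _; ring.
rewrite !alpha_connectionE// (fisherC g) !fisher_christoffel//.
rewrite (_ : E (fun x => f x * h x * g x / _) =
             E (fun x => f x * g x * h x / (mu x * mu x))); last first.
  by apply: eq_Rintegral => x _; ring.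
rewrite (_ : _ + _ = E (fun x => - (g x * h x * f x / (mu x * mu x)))); last first.
  rewrite -mulrDl -integral_scale//; last by continuity.
  by apply: eq_Rintegral => x _; field; rewrite gt_eqF.
have cgh : continuous (fun x => g x * h x) by continuity.
have [C FC] := expands_integral_div_line cgh tf muP.
apply: (near_eq_is_derive (f := fun t => E (fun x => g x * h x / line mu t f x))).
  by apply: filterS (near_line_Pplus muP tf) => t [_ lt0 _]; rewrite fisherE.
by apply: (@is_derive_quadratic _ _ _ C); apply: filterS FC => t /(_ point).
Qed.


Lemma covariant_deriv_const alpha f h mu :
  tangent f -> tangent h -> Pplus mu ->
  covariant_deriv (nabla alpha) f (cst h) mu = alpha_christoffel alpha f h mu.
Proof.
move=> [cf _] [ch _] muP; rewrite /covariant_deriv alpha_connectionE//.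
rewrite (@expands_curve_deriv0 _ _ (fun=> h) (fun=> 0)).
  by apply/funext => x; rewrite add0r.
by apply: expands_exact => t x; rewrite mulr0 addr0.
Qed.

Lemma expands_christoffel alpha f g h mu :
  tangent f -> tangent g -> tangent h -> Pplus mu ->
  expands (fun t => alpha_christoffel alpha g h (line mu t f))
    (fun x => - ((1 + alpha) / 2) *
      (- (g x * h x * f x / (mu x * mu x))
       + - (E (fun y => g y * h y / mu y) * f x
            + E (fun y => - (g y * h y * f y / (mu y * mu y))) * mu x))).
Proof.
move=> tf tg th muP; have [cf _] := tf; have [cg _] := tg; have [ch _] := th.
have [cmu mu0 _] := muP; have mumu0 x : 0 < mu x * mu x by exact: mulr_gt0.
have cgh : continuous (fun x => g x * h x) by continuity.
have bd p : continuous p -> bounded_fun p by exact: continuous_bounded_fun.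
have line0 : line mu 0 f = mu by apply/funext => x; rewrite /line mul0r addr0.
apply: expands_scale; apply: expands_add; first exact: expands_div_line.
rewrite (_ : (fun x => - _) = (fun x => -1 *
    (E (fun y => g y * h y / line mu 0 f y) * f x
     + E (fun y => - (g y * h y * f y / (mu y * mu y))) * line mu 0 f x)));
  last first.
  by apply/funext => x; rewrite line0 mulN1r.
rewrite (_ : (fun t x => - _) = (fun t x => -1 *
    (E (fun y => g y * h y / line mu t f y) * line mu t f x))); last first.
  by apply/funext => t; apply/funext => x; rewrite mulN1r.
apply: expands_scale.
apply: (@expands_mul _ _ (fun t _ => E (fun y => g y * h y / line mu t f y))
  (fun t => line mu t f)
  (fun=> E (fun y => - (g y * h y * f y / (mu y * mu y)))) f).
- by apply: (bd (fun=> _)); continuity.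
- by apply: (bd (fun=> _)); continuity.
- by rewrite line0; exact: bd.
- exact: bd.
- exact: expands_integral_div_line.
- exact: expands_line.
Qed.

Lemma integral_mul_christoffel alpha f g h mu :
  tangent f -> tangent g -> tangent h -> Pplus mu ->
  E (fun x => f x * alpha_christoffel alpha g h mu x / mu x) =
  - ((1 + alpha) / 2) * E (fun x => g x * h x * f x / (mu x * mu x)).
Proof.
move=> tf [cg _] [ch _] muP; have [_ mu0 _] := muP.
rewrite -fisher_christoffel// fisherE//.
by apply: eq_Rintegral => x _; rewrite [f x * _]mulrC.
Qed.

(** In the second covariant derivative, the triple products f g h and their
integrals are symmetric in f and g.  There remain (k - k^2) G(g, h) f and its
counterpart: k from the derivative of the normalizing term G(g, h) mu, and - k^2
from the action of the connection on it. *)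
Lemma curvatureE alpha f g h mu :
  tangent f -> tangent g -> tangent h -> Pplus mu ->
  curvature (nabla alpha) f g h mu = fun x => (1 - alpha ^+ 2) / 4 *
    (fisher lam mu g h * f x - fisher lam mu f h * g x).
Proof.
move=> tf tg th muP.
have covE f1 g1 x : tangent f1 -> tangent g1 ->
  covariant_deriv (nabla alpha) f1 (covariant_deriv (nabla alpha) g1 (cst h)) mu x
  = - ((1 + alpha) / 2) *
      (- (g1 x * h x * f1 x / (mu x * mu x))
       + - (E (fun y => g1 y * h y / mu y) * f1 x
            + E (fun y => - (g1 y * h y * f1 y / (mu y * mu y))) * mu x))
    + - ((1 + alpha) / 2) *
      (f1 x * alpha_christoffel alpha g1 h mu x / mu x
       - - ((1 + alpha) / 2) *
           E (fun y => g1 y * h y * f1 y / (mu y * mu y)) * mu x).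
  move=> tf1 tg1; have [cf1 _] := tf1; have [cg1 _] := tg1; have [ch _] := th.
  rewrite {1}/covariant_deriv covariant_deriv_const//.
  rewrite alpha_connectionE//; last first.
    by have [] := alpha_christoffel_tangent alpha cg1 ch muP.
  congr (_ + _); last first.
    by rewrite {1}/alpha_christoffel integral_mul_christoffel.
  rewrite (@expands_curve_deriv0 _ _ _ _ (expands_near _
    (expands_christoffel alpha tf1 tg1 th muP)))//.
  apply: filterS (near_line_Pplus muP tf1) => t Pt.
  by rewrite covariant_deriv_const.
apply/funext => x; have [_ mu0 _] := muP.
rewrite /curvature !covE// !fisherE//.
have E1 : E (fun y => f y * h y * g y / (mu y * mu y)) =
          E (fun y => g y * h y * f y / (mu y * mu y)).
  by apply: eq_Rintegral => y _; ring.
have E2 : E (fun y => - (f y * h y * g y / (mu y * mu y))) =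
          E (fun y => - (g y * h y * f y / (mu y * mu y))).
  by apply: eq_Rintegral => y _; ring.
rewrite E1 E2 /alpha_christoffel.
by field; rewrite gt_eqF.
Qed.

End alpha_connections.

(** * Flatness forces alpha = 1 or alpha = -1 *)

Lemma atlas_two_points (R : realType) (n : nat) (M : ptopologicalType)
    (A : smooth_atlas R n M) : (0 < n)%N -> exists x y : M, x != y.
Proof.
move=> n0; have [i ip] := atlas_cover A point.
set c := atlas_chart i; pose y0 := chart_map c point.
have : nbhs y0 (chart_map c @` chart_dom c).
  by apply: open_nbhs_nbhs; split; [exact: chart_codom_open|exists point].
move=> /nbhs_ballP[e /= e0 eV].
have [x cx cxE] : (chart_map c @` chart_dom c) (y0 + const_mx (e / 2)).
  apply: eV; split=> // k j; rewrite !mxE -ball_normE/=.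
  rewrite opprD addrA subrr sub0r normrN ger0_norm ?divr_ge0 ?ltW//.
  by rewrite ltr_pdivrMr// ltr_pMr// ltr1n.
exists point, x; apply/eqP => px; move: cxE; rewrite -px -/y0.
move=> /(congr1 (fun y : 'rV[R]_n => y 0 (Ordinal n0))); rewrite !mxE.
move=> /eqP; rewrite -subr_eq0 opprD addrA subrr sub0r oppr_eq0 gt_eqF//.
by rewrite divr_gt0.
Qed.

(** Three values make g and g^2 independent modulo constants; with two values,
g^2 would be an affine function of g. *)
Lemma exists_three_valued (R : realType) (M : topologicalType) (x y : M) :
  hausdorff_space M -> compact [set: M] -> connected [set: M] -> x != y ->
  exists (g : M -> R) (z : M),
    [/\ continuous g, g x = 0, g y = 1 & g z = 2^-1].
Proof.
move=> hM cM conM xy.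
have cl1 := accessible_closed_set1 (hausdorff_accessible hM).
have dxy : [set x] `&` [set y] = set0.
  by apply/seteqP; split => // w [-> xy']; move: xy; rewrite xy' eqxx.
have /(@uniform_separatorP M R)[g [cg _ gx gy]] :=
  normal_uniform_separator (compact_normal hM cM) (cl1 x) (cl1 y) dxy.
have gx0 : g x = 0 by apply: gx; exists x.
have gy1 : g y = 1 by apply: gy; exists y.
have : connected (g @` [set: M]).
  by apply: connected_continuous_connected => //; exact: continuous_subspaceT.
move=> /connected_intervalP itv_g.
have [z _ gz] : (g @` [set: M]) 2^-1.
  apply: (itv_g 0 1); [by exists x|by exists y|].
  by rewrite invr_ge0 ler0n /= invf_le1// ler1n.
by exists g, z.
Qed.

Lemma flat_alpha_connectionP (R : realType) (n : nat) (M : ptopologicalType)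
    (A : smooth_atlas R n M)
    (lam : {measure set (borel M) -> \bar R}) (alpha : R) :
  (0 < n)%N -> hausdorff_space M -> compact [set: M] -> connected [set: M] ->
  lam setT = 1%E ->
  (forall U : set M, open U -> U !=set0 -> (0 < lam U)%E) ->
  flat lam (alpha_connection lam alpha) <-> alpha = 1 \/ alpha = -1.
Proof.
move=> n0 hM cM conM lam1 lam_open.
split=> [flat_alpha|a1]; last first.
  move=> f g h mu tf tg th muP x; rewrite curvatureE//.
  have -> : 1 - alpha ^+ 2 = 0 by case: a1 => ->; ring.
  by rewrite !mul0r.
have [x [y xy]] := atlas_two_points A n0.
have [g [z [cg gx gy gz]]] := exists_three_valued R hM cM conM xy.
pose g1 (w : M) := g w - \int[lam]_(y in setT) g y.
pose g2 (w : M) := g w * g w - \int[lam]_(y in setT) (g y * g y).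
have tcenter (f : M -> R) : continuous f ->
    tangent lam (fun w => f w - \int[lam]_(y in setT) f y).
  move=> cf; have cc := @continuous_cst_fun R M (\int[lam]_(y in setT) f y).
  by split; [continuity|rewrite integral_sub// integral_const// subrr].
have tg1 : tangent lam g1 by exact: tcenter.
have tg2 : tangent lam g2 by apply: (tcenter (fun w => g w * g w)); continuity.
have one : Pplus lam (fun=> 1).
  by split; [exact: continuous_cst_fun|move=> _; exact: ltr01|exact: integral_const].
have curv0 w : (1 - alpha ^+ 2) / 4 * (fisher lam (fun=> 1) g1 g1 * g2 w
    - fisher lam (fun=> 1) g2 g1 * g1 w) = 0.
  by rewrite -(flat_alpha g2 g1 g1 _ tg2 tg1 tg1 one w) curvatureE.
suff /eqP : (1 - alpha) * (1 + alpha) = 0.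
  rewrite mulf_eq0 subr_eq0 addrC addr_eq0 => /orP[/eqP<-|/eqP->]; by [left|right].
apply/eqP/negP => /negP a1.
set a := fisher lam _ g1 g1 in curv0; set b := fisher lam _ g2 g1 in curv0.
have ab w : a * g2 w = b * g1 w.
  apply/eqP; rewrite -subr_eq0; apply/eqP.
  have /eqP := curv0 w; rewrite mulf_eq0 => /orP[/eqP a0|/eqP//].
  by exfalso; move/eqP: a1; apply; lra.
(* Subtracting the relation at x from those at y and z gives a = b and
   a / 4 = b / 2. *)
have a0 : a = 0.
  have := ab x; have := ab y; have := ab z.
  by rewrite /g1 /g2 gx gy gz; lra.
(* a = G(g1, g1) at mu = lam *)
have gE w : g1 w = 0.
  have : g1 w * g1 w = 0.
    apply: (@integral_eq0_continuous R M lam cM lam1 lam_open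
      (fun w => g1 w * g1 w)).
    - by apply: continuous_mul; case: tg1.
    - by move=> v; rewrite -expr2; exact: sqr_ge0.
    - rewrite -[RHS]a0 /a fisherE//.
      by apply: eq_Rintegral => v _; rewrite divr1.
  by move=> /eqP; rewrite mulf_eq0 orbb => /eqP.
by have := gE x; have := gE y; rewrite /g1 gx gy; lra.
Qed.
Theorem corollary3p5 (R : realType) (n : nat) (M : ptopologicalType)
    (A : smooth_atlas R n M) (omega : volume_form A)
    (lam : {measure set (borel M) -> \bar R})
    (hn : (0 < n)%N)
    (hT2 : hausdorff_space M) (hM2 : @second_countable M)
    (hMc : compact [set: M]) (hMconn : connected [set: M])
    (hlam : is_volume_measure omega lam)
    (hlam1 : lam setT = 1%E)
    (alpha : R) :
  [/\ dual_connections lam (alpha_connection lam alpha)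
        (alpha_connection lam (- alpha)),
      flat lam (alpha_connection lam alpha) &
      flat lam (alpha_connection lam (- alpha))]
  <-> alpha = 1 \/ alpha = -1.
Proof.
have lam_open U : open U -> U !=set0 -> (0 < lam U)%E.
  exact: measure_open_gt0 hlam.
have flatE a : flat lam (alpha_connection lam a) <-> a = 1 \/ a = -1.
  exact: (flat_alpha_connectionP A).
split=> [[_ /flatE//]|a1]; split.
- exact: dual_alpha_connections.
- exact/flatE.
- by apply/flatE; case: a1 => ->; rewrite ?opprK; [right|left].
Qed.
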